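(* Let $A\in\mathbb{R}^{n\times n}$ be symmetric, $g\in\mathbb{R}^n$ nonzero, $\Delta>0$, and suppose that the solution $s_{opt}$ of the trust-region subproblem $\min_{\|s\|\le\Delta} g^Ts+\frac12 s^TAs$ satisfies $\|s_{opt}\|=\Delta$, in the easy case. Let $$M=\begin{pmatrix}-A & \frac{gg^T}{\Delta^2}\\ I & -A\end{pmatrix}\in\mathbb{R}^{2n\times 2n},$$ let $\mu_1$ be the rightmost eigenvalue of $M$ and $y$ a corresponding real unit eigenvector. Let $\mathcal{K}_k(v_1,M)$ be the $k$-dimensional Krylov subspace with orthonormal basis matrix $V_k$, let $\mu_1^{(k)}$ be the rightmost Ritz value of $M$ with respect to $\mathcal{K}_k(v_1,M)$, and let $\widetilde y^{(k)}=\begin{pmatrix}\widetilde y_1^{(k)}\\ \widetilde y_2^{(k)}\end{pmatrix}$ be the refined Ritz vector, that is, a unit vector in $\mathcal{K}_k(v_1,M)$ with $$\|(M-\mu_1^{(k)}I)\widetilde y^{(k)}\|=\min_{x\in\mathcal{K}_k(v_1,M),\ \|x\|=1}\|(M-\mu_1^{(k)}I)x\|.$$ Let $s_{\mathrm{RA}}^{(k)}$ be the refined Arnoldi approximation $$s_{\mathrm{RA}}^{(k)}=-\frac{\Delta^2}{g^T\widetilde y_2^{(k)}}\,\widetilde y_1^{(k)}=-\operatorname{sign}(g^T\widetilde y_2^{(k)})\,\Delta\,\frac{\widetilde y_1^{(k)}}{\|\widetilde y_1^{(k)}\|}$$ (both equalities being assumed to hold). Let $\varepsilon_k=\sin\angle(y,\mathcal{K}_k(v_1,M))$,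 $\pi_k=V_kV_k^T$ and $\gamma_k=\|\pi_kM(I-\pi_k)\|$, and let $\kappa(\mu_1^{(k)})$ be the spectral condition number of $\mu_1^{(k)}$. Then, for $\varepsilon_k$ small, $$\|(A+\mu_1^{(k)}I)s_{\mathrm{RA}}^{(k)}+g\|\le\frac{\left(\|M-\mu_1^{(k)}I\|+\kappa(\mu_1^{(k)})\gamma_k\right)\Delta}{\|\widetilde y_1^{(k)}\|\sqrt{1-\varepsilon_k^2}}\,\varepsilon_k+\mathcal{O}(\varepsilon_k^2).$$
   Context: $\|\cdot\|$ is the 2-norm of a vector or matrix. ''Rightmost'' means having the largest real part. Easy case: it is not the case that both $g$ is orthogonal to the eigenspace of $A$ for its smallest eigenvalue $\alpha_n$ and the optimal Lagrange multiplier equals $-\alpha_n$. Here the optimal multiplier is the $\lambda_{opt}\ge0$ with $(A+\lambda_{opt}I)s_{opt}=-g$, $\lambda_{opt}(\Delta-\|s_{opt}\|)=0$ and $A+\lambda_{opt}I\succeq0$. It is known that, when $\|s_{opt}\|=\Delta$, the rightmost eigenvalue $\mu_1$ of $M$ is real and simple and equals $\lambda_{opt}$. Krylov subspace: $\mathcal{K}_k(v_1,M)=\operatorname{span}\{v_1,Mv_1,\dots,M^{k-1}v_1\}$ for a unit vector $v_1\in\mathbb{R}^{2n}$, assumed to have dimension $k$. $V_k\in\mathbb{R}^{2n\times k}$ has orthonormal columns spanning it, and $H_k=V_k^TMV_k\in\mathbb{R}^{k\times k}$ is the matrix representation of the restriction of $\pi_kM\pi_k$ to this subspace. The rightmost Ritz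 value $\mu_1^{(k)}$ is the rightmost eigenvalue of $H_k$, used as the approximation to $\mu_1$; it and the vector $\widetilde y^{(k)}$ are taken to be real. The blocks $\widetilde y_1^{(k)},\widetilde y_2^{(k)}$ lie in $\mathbb{R}^n$, with $\widetilde y_1^{(k)}\neq0$ and $g^T\widetilde y_2^{(k)}\neq0$. $\angle(y,\mathcal{K})$ is the acute angle between $y$ and the subspace $\mathcal{K}$, so $\varepsilon_k=\|(I-\pi_k)y\|$. $\kappa(\mu_1^{(k)})$ is the spectral condition number of $\mu_1^{(k)}$ as a (simple) eigenvalue of $H_k$, i.e. $1/|u^Hz|$ for unit left and right eigenvectors $u,z$ of $H_k$ for $\mu_1^{(k)}$. $\mathcal{O}(\varepsilon_k^2)$ is understood in the sense of first-order eigenvalue perturbation theory: a second-order remainder, bounded by a constant times $\varepsilon_k^2$ for $\varepsilon_k$ small, where the constant may depend on $A,g,\Delta$ and on the spectral data of $H_k$.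
   Formalization: The remainder constant and the smallness threshold for ε_k depend on A, g, Δ, k, an upper bound for κ(μ_1^{(k)}), and a d>0 such that every other eigenvalue of H_k lies at distance at least d from μ_1; without such a separation the rightmost Ritz value need not approximate μ_1. *)

(* Defs.v *)
From HB Require Import structures.
From mathcomp Require Import all_boot all_order all_algebra.
From mathcomp Require Import complex.
From mathcomp Require Import classical_sets reals trigo.

Set Implicit Arguments.
Unset Strict Implicit.
Unset Printing Implicit Defensive.

Import Order.TTheory GRing.Theory Num.Theory.

Local Open Scope ring_scope.
Local Open Scope classical_set_scope.
Local Open Scope complex_scope.

Section Euclidean.
Context {R : realType}.

Definition dotv {m : nat} (x y : 'cV[R]_m) : R := \sum_i x i 0 * y i 0.

(* The library norm `|x| on matrices is the sup norm, hence a separate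
   definition of the 2-norm of a vector and of a matrix. *)
Definition norm2 {m : nat} (x : 'cV[R]_m) : R := Num.sqrt (dotv x x).

Definition opnorm2 {m p : nat} (B : 'M[R]_(m, p)) : R :=
  sup [set norm2 (B *m x) | x in [set x : 'cV[R]_p | norm2 x = 1]].

Definition orthonormal_cols {m p : nat} (V : 'M[R]_(m, p)) : Prop :=
  V^T *m V = 1%:M.

(* Orthogonal projector onto the column space of V, for orthonormal columns. *)
Definition orth_proj {m p : nat} (V : 'M[R]_(m, p)) : 'M[R]_m := V *m V^T.

(* Acute angle between a nonzero vector and a subspace with orthogonal
   projector P, i.e. the angle between y and its projection P y, whose cosine
   is |P y| / |y|. *)
Definition subspace_angle {m : nat} (y : 'cV[R]_m) (P : 'M[R]_m) : R :=
  acos (norm2 (P *m y) / norm2 y).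

End Euclidean.

Section Spectrum.
Context {R : realType}.

Definition complexify {m p : nat} (B : 'M[R]_(m, p)) : 'M[R[i]]_(m, p) :=
  map_mx (fun x : R => x%:C) B.

(* The rightmost eigenvalue among all complex eigenvalues, when it is real. *)
Definition rightmost_eigenvalue {m : nat} (B : 'M[R]_m) (mu : R) : Prop :=
  eigenvalue B mu /\
  forall z : R[i], eigenvalue (complexify B) z -> complex.Re z <= mu.

Definition simple_eigenvalue {m : nat} (B : 'M[R]_m) (mu : R) : Prop :=
  mup mu (char_poly B) = 1%N.

(* For a real simple eigenvalue of a real matrix, unit eigenvectors are
   determined up to a factor of modulus 1 and may be taken real. *)
Definition eigenvalue_condition {m : nat} (B : 'M[R]_m) (mu kappa : R) : Prop :=
  exists u z : 'cV[R]_m,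
    [/\ norm2 u = 1, norm2 z = 1,
        u^T *m B = mu *: u^T, B *m z = mu *: z
      & kappa = `|dotv u z|^-1].

(* All complex eigenvalues of B other than mu lie at distance at least d
   from the point nu. *)
Definition other_eigenvalues_apart {m : nat} (B : 'M[R]_m) (mu nu d : R)
    : Prop :=
  forall z : R[i], eigenvalue (complexify B) z -> z != mu%:C ->
    d%:C <= `|z - nu%:C|.

Definition smallest_eigenvalue {m : nat} (B : 'M[R]_m) (alpha : R) : Prop :=
  eigenvalue B alpha /\ forall beta : R, eigenvalue B beta -> alpha <= beta.

Definition orth_eigenspace {m : nat} (B : 'M[R]_m) (alpha : R)
    (x : 'cV[R]_m) : Prop :=
  forall v : 'cV[R]_m, B *m v = alpha *: v -> dotv x v = 0.

End Spectrum.

Section TrustRegion.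
Context {R : realType} {n : nat}.

Definition trs_objective (A : 'M[R]_n) (g s : 'cV[R]_n) : R :=
  dotv g s + 2^-1 * dotv s (A *m s).

Definition trs_solution (A : 'M[R]_n) (g : 'cV[R]_n) (Delta : R)
    (s : 'cV[R]_n) : Prop :=
  norm2 s <= Delta /\
  forall s' : 'cV[R]_n, norm2 s' <= Delta ->
    trs_objective A g s <= trs_objective A g s'.

Definition psd (B : 'M[R]_n) : Prop :=
  forall x : 'cV[R]_n, 0 <= dotv x (B *m x).

Definition optimal_multiplier (A : 'M[R]_n) (g : 'cV[R]_n) (Delta : R)
    (s : 'cV[R]_n) (lam : R) : Prop :=
  [/\ 0 <= lam, (A + lam%:M) *m s = - g,
      lam * (Delta - norm2 s) = 0 & psd (A + lam%:M)].

Definition easy_case (A : 'M[R]_n) (g : 'cV[R]_n) (lam : R) : Prop :=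
  forall alpha : R, smallest_eigenvalue A alpha ->
    ~ (orth_eigenspace A alpha g /\ lam = - alpha).

Definition trs_mx (A : 'M[R]_n) (g : 'cV[R]_n) (Delta : R) : 'M[R]_(n + n) :=
  block_mx (- A) ((Delta ^+ 2)^-1 *: (g *m g^T)) 1%:M (- A).

End TrustRegion.

Section Krylov.
Context {R : realType} {m : nat}.

(* The rows are (M ^ j v)^T for j < k, so that the Krylov subspace is the row
   space of this matrix. *)
Definition krylov_mx (k : nat) (v : 'cV[R]_m) (M : 'M[R]_m) : 'M[R]_(k, m) :=
  \matrix_(j < k) (iter j (mulmx M) v)^T.

Definition in_krylov (k : nat) (v : 'cV[R]_m) (M : 'M[R]_m) (x : 'cV[R]_m)
    : bool :=
  (x^T <= krylov_mx k v M)%MS.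

Definition krylov_onb (k : nat) (v : 'cV[R]_m) (M : 'M[R]_m)
    (V : 'M[R]_(m, k)) : Prop :=
  orthonormal_cols V /\ (V^T == krylov_mx k v M)%MS.

Definition refined_ritz_vector (k : nat) (v : 'cV[R]_m) (M : 'M[R]_m) (mu : R)
    (x : 'cV[R]_m) : Prop :=
  [/\ in_krylov k v M x, norm2 x = 1
    & forall x' : 'cV[R]_m, in_krylov k v M x' -> norm2 x' = 1 ->
        norm2 ((M - mu%:M) *m x) <= norm2 ((M - mu%:M) *m x')].

End Krylov.

(* Main.v *)
Require Import Defs.
From HB Require Import structures.
From mathcomp Require Import all_boot all_order all_algebra.
From mathcomp Require Import perm complex.
From mathcomp Require Import classical_sets reals trigo.
From mathcomp Require Import ring lra.

(** Write mu for the Ritz value, e for the sine of the angle between y and the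
    Krylov subspace, P = V V^T, x~ for the refined Ritz vector with blocks x1
    and x2, and N for the norm of M.

    The residual (A + mu) s + g is Delta^2 / (g^T x2) times the first block of
    (M - mu) x~ ([trs_residual_le]), and the agreement of the two formulas for
    s says that this factor has absolute value Delta / |x1|.  By minimality the
    refined residual is at most that of P y / |P y|, and |P y| = sqrt (1 - e^2).
    As P y differs from the eigenvector y by a vector of norm e,
      sqrt (1 - e^2) |(M - mu) x~| <= |mu - mu1| + |M - mu| e
    ([refined_residual_le], [proj_residual_le]).

    It remains to see that |mu - mu1| <= kappa gamma e + O(e^2), which is
    [ritz_value_distance].  The vector x = V^T y is almost an eigenvector of H
    for mu1: |(H - mu1) x| <= gamma e.  Let u and z be unit left and right
    eigenvectors of H for mu, so that kappa = 1 / |u^T z|.  Then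
    (mu - mu1) u^T x = u^T (H - mu1) x.  Split x = a z + w with u^T w = 0; thus
    |u^T x| = |a| / kappa and |a| >= |x| - |w|, and it suffices that w = O(e).
    This holds because H - mu1 is boundedly invertible on the complement of z
    orthogonal to u, with a bound that depends only on k, N, mu1, d and kbar.
    To get that bound without restricting H to a subspace, H is deflated:
    B = H - s z u^T / (u^T z) acts as H on that complement, while its
    characteristic polynomial is that of H with the root mu moved to mu - s.
    Choosing s so that mu - s = mu1 - 1, the determinant of mu1 - B is the value
    at mu1 of the characteristic polynomial of H divided by X - mu; it has
    modulus at least d^(k-1) by the separation hypothesis, and the adjugate of
    mu1 - B is bounded through its entries.

    Finally the constant in the remainder has to be independent of |x1|, which
    occurs in a denominator.  In the easy case A + mu1 is positive definite, and
    since the second block of (M - mu) x~ is x1 - (A + mu) x2, a small residual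
    forces |x1| to stay above a constant that depends on A and mu1 only
    ([shifted_mx_unit], [first_block_lower_bound]). *)

Set Implicit Arguments.
Unset Strict Implicit.
Unset Printing Implicit Defensive.

Import Order.TTheory GRing.Theory Num.Theory.

Local Open Scope ring_scope.

(** * Euclidean and operator norms *)

Section EuclideanNorm.
Context {R : realType}.
Implicit Types m p : nat.

Lemma dotvE m (x y : 'cV[R]_m) : dotv x y = (x^T *m y) 0 0.
Proof. by rewrite mxE; apply: eq_bigr => i _; rewrite mxE. Qed.

Lemma dotvC m (x y : 'cV[R]_m) : dotv x y = dotv y x.
Proof. by apply: eq_bigr => i _; rewrite mulrC. Qed.

Lemma dotvDr m (x y z : 'cV[R]_m) : dotv x (y + z) = dotv x y + dotv x z.
Proof. by rewrite !dotvE mulmxDr mxE. Qed.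

Lemma dotvZr m a (x y : 'cV[R]_m) : dotv x (a *: y) = a * dotv x y.
Proof. by rewrite !dotvE -scalemxAr mxE. Qed.

Lemma dotvNr m (x y : 'cV[R]_m) : dotv x (- y) = - dotv x y.
Proof. by rewrite -scaleN1r dotvZr mulN1r. Qed.

Lemma dotv_mulmxl m p (B : 'M[R]_(m, p)) x y :
  dotv (B *m x) y = dotv x (B^T *m y).
Proof. by rewrite !dotvE trmx_mul mulmxA. Qed.

Lemma dotvv_ge0 m (x : 'cV[R]_m) : 0 <= dotv x x.
Proof. by apply: sumr_ge0 => i _; rewrite -expr2 sqr_ge0. Qed.

Lemma norm2_ge0 m (x : 'cV[R]_m) : 0 <= norm2 x.
Proof. exact: sqrtr_ge0. Qed.

Lemma sqr_norm2 m (x : 'cV[R]_m) : norm2 x ^+ 2 = dotv x x.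
Proof. by rewrite sqr_sqrtr ?dotvv_ge0. Qed.

Lemma norm2_eq0 m (x : 'cV[R]_m) : (norm2 x == 0) = (x == 0).
Proof.
apply/eqP/eqP => [x0|->]; last first.
  by rewrite /norm2 /dotv big1 ?sqrtr0 // => i _; rewrite mxE mul0r.
have := sqr_norm2 x; rewrite x0 expr0n /= => /esym/eqP.
rewrite psumr_eq0 => [/allP xx0|i _]; last by rewrite -expr2 sqr_ge0.
apply/matrixP => i j; rewrite ord1 mxE.
by have := xx0 i (mem_index_enum i); rewrite mulf_eq0 orbb => /eqP.
Qed.

Lemma norm2Z m a (x : 'cV[R]_m) : norm2 (a *: x) = `|a| * norm2 x.
Proof.
rewrite /norm2 dotvZr dotvC dotvZr mulrA -expr2 sqrtrM ?sqr_ge0 //.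
by rewrite sqrtr_sqr.
Qed.

Lemma norm2N m (x : 'cV[R]_m) : norm2 (- x) = norm2 x.
Proof. by rewrite -scaleN1r norm2Z normrN1 mul1r. Qed.

Lemma sqr_norm2D m (x y : 'cV[R]_m) :
  norm2 (x + y) ^+ 2 = norm2 x ^+ 2 + dotv x y *+ 2 + norm2 y ^+ 2.
Proof.
rewrite !sqr_norm2 dotvDr dotvC dotvDr (dotvC (x + y)) dotvDr (dotvC y x).
by ring.
Qed.

(** Expand the square of the norm of |y| x - |x| y. *)
Lemma dotv_le m (x y : 'cV[R]_m) : dotv x y <= norm2 x * norm2 y.
Proof.
have [->|x0] := eqVneq x 0.
  by rewrite dotvC -(scale0r 0) dotvZr mul0r mulr_ge0 ?norm2_ge0.
have [->|y0] := eqVneq y 0.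
  by rewrite -(scale0r 0) dotvZr mul0r mulr_ge0 ?norm2_ge0.
have nx : 0 < norm2 x by rewrite lt_def norm2_eq0 x0 norm2_ge0.
have ny : 0 < norm2 y by rewrite lt_def norm2_eq0 y0 norm2_ge0.
have := sqr_ge0 (norm2 (norm2 y *: x + (- norm2 x) *: y)).
rewrite sqr_norm2D dotvZr (dotvC (_ *: x)) dotvZr (dotvC y) !norm2Z normrN.
rewrite !ger0_norm ?norm2_ge0 // => h.
have {h} : 0 <= (norm2 x * norm2 y) * ((norm2 x * norm2 y - dotv x y) *+ 2).
  by apply: le_trans h _; rewrite le_eqVlt; apply/orP; left; apply/eqP; ring.
by rewrite pmulr_rge0 ?mulr_gt0 // pmulrn_lge0 // subr_ge0.
Qed.

Lemma norm_dotv_le m (x y : 'cV[R]_m) : `|dotv x y| <= norm2 x * norm2 y.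
Proof.
rewrite ler_norml dotv_le andbT lerNl -dotvNr.
by apply: le_trans (dotv_le _ _) _; rewrite norm2N.
Qed.

Lemma norm2D m (x y : 'cV[R]_m) : norm2 (x + y) <= norm2 x + norm2 y.
Proof.
rewrite -ler_sqr ?nnegrE ?addr_ge0 ?norm2_ge0 // sqr_norm2D sqrrD.
by rewrite lerD2r lerD2l lerMn2r dotv_le.
Qed.

Lemma norm2B m (x y : 'cV[R]_m) : norm2 (x - y) <= norm2 x + norm2 y.
Proof. by apply: le_trans (norm2D _ _) _; rewrite norm2N. Qed.

Lemma norm_entry_le m (x : 'cV[R]_m) i : `|x i 0| <= norm2 x.
Proof.
rewrite -sqrtr_sqr ler_sqrt ?dotvv_ge0 // /dotv (bigD1 i) //= -expr2 lerDl.
by apply: sumr_ge0 => j _; rewrite -expr2 sqr_ge0.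
Qed.

Lemma norm2_le_sum m (x : 'cV[R]_m) : norm2 x <= \sum_i `|x i 0|.
Proof.
have s0 : 0 <= \sum_i `|x i 0| by apply: sumr_ge0.
rewrite -ler_sqr ?nnegrE ?norm2_ge0 // sqr_norm2 expr2 mulr_suml.
apply: ler_sum => i _; apply: le_trans (ler_norm _) _; rewrite normrM.
by rewrite ler_wpM2l // (bigD1 i) //= lerDl sumr_ge0.
Qed.

Lemma sum_ord_le m (F : 'I_m -> R) c :
  (forall i, F i <= c) -> \sum_i F i <= m%:R * c.
Proof.
move=> Fc; apply: le_trans (ler_sum _ (fun i _ => Fc i)) _.
by rewrite sumr_const card_ord mulr_natl.
Qed.

Lemma norm2_mulmx_entries m p (B : 'M[R]_(m, p)) b x :
  (forall i j, `|B i j| <= b) ->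
  norm2 (B *m x) <= m%:R * p%:R * b * norm2 x.
Proof.
move=> Bb; apply: le_trans (norm2_le_sum _) _.
rewrite -!mulrA; apply: sum_ord_le => i.
rewrite mxE; apply: le_trans (ler_norm_sum _ _ _) _; apply: sum_ord_le => j.
by rewrite normrM ler_pM ?norm_entry_le.
Qed.

(** The supremum that defines the operator norm is finite, hence an upper bound,
    because the entries of B bound B on the unit sphere. *)
Lemma norm2_mulmx_le m p (B : 'M[R]_(m, p)) x :
  norm2 (B *m x) <= opnorm2 B * norm2 x.
Proof.
have [->|x0] := eqVneq x 0.
  rewrite mulmx0; have /eqP -> : norm2 (0 : 'cV[R]_m) == 0 by rewrite norm2_eq0.
  have /eqP -> : norm2 (0 : 'cV[R]_p) == 0 by rewrite norm2_eq0.
  by rewrite mulr0.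
have nx : 0 < norm2 x by rewrite lt_def norm2_eq0 x0 norm2_ge0.
rewrite -ler_pdivrMr // mulrC -[(norm2 x)^-1]gtr0_norm ?invr_gt0 // -norm2Z.
rewrite scalemxAr; apply: ub_le_sup; last first.
  exists ((norm2 x)^-1 *: x) => //=.
  by rewrite norm2Z gtr0_norm ?invr_gt0 // mulVf ?gt_eqF.
exists (m%:R * p%:R * (\sum_i \sum_j `|B i j|)) => _ [z /= z1 <-].
rewrite -[leRHS]mulr1 -[X in _ * X]z1; apply: norm2_mulmx_entries => i j.
rewrite (bigD1 i) //= (bigD1 j) //= -addrA lerDl addr_ge0 // ?sumr_ge0 //.
by move=> i' _; rewrite sumr_ge0.
Qed.

Lemma opnorm2_ge0 m p (B : 'M[R]_(m, p)) : 0 <= opnorm2 B.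
Proof.
rewrite /opnorm2; set S := (X in sup X).
have [S0|/set0P [t St]] := eqVneq S set0.
  by rewrite S0 sup0.
case: (St) => x /= x1 _; rewrite -/S.
by have := norm2_mulmx_le B x; rewrite x1 mulr1; apply: le_trans;
   exact: norm2_ge0.
Qed.

Lemma opnorm2_le m p (B : 'M[R]_(m, p)) c : 0 <= c ->
  (forall x, norm2 x = 1 -> norm2 (B *m x) <= c) -> opnorm2 B <= c.
Proof.
move=> c0 Bc; rewrite /opnorm2; set S := (X in sup X).
have [-> |/set0P S0] := eqVneq S set0; first by rewrite sup0.
by apply: ge_sup => // _ [x /= x1 <-]; exact: Bc.
Qed.

End EuclideanNorm.

(** * Projections and angles *)

Section OrthogonalProjection.
Context {R : realType} {m k : nat} (V : 'M[R]_(m, k)).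
Hypothesis orthoV : orthonormal_cols V.

Lemma norm2_isometry x : norm2 (V *m x) = norm2 x.
Proof. by rewrite /norm2 dotv_mulmxl mulmxA orthoV mul1mx. Qed.

Lemma norm2_orth_proj x : norm2 (orth_proj V *m x) = norm2 (V^T *m x).
Proof. by rewrite -mulmxA norm2_isometry. Qed.

Lemma orth_proj_pythagoras x :
  norm2 (V^T *m x) ^+ 2 + norm2 (x - orth_proj V *m x) ^+ 2 = norm2 x ^+ 2.
Proof.
have PN : dotv (orth_proj V *m x) (x - orth_proj V *m x) = 0.
  rewrite -mulmxA dotv_mulmxl mulmxBr !mulmxA orthoV mul1mx subrr dotvE.
  by rewrite mulmx0 mxE.
have -> : norm2 x = norm2 (x - orth_proj V *m x + orth_proj V *m x).
  by rewrite subrK.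
by rewrite [RHS]sqr_norm2D dotvC PN mul0rn addr0 norm2_orth_proj addrC.
Qed.

Lemma norm2_trmx_isometry_le x : norm2 (V^T *m x) <= norm2 x.
Proof.
rewrite -ler_sqr ?nnegrE ?norm2_ge0 // -[leRHS]orth_proj_pythagoras lerDl.
exact: sqr_ge0.
Qed.

Lemma norm2_orth_compl_le x : norm2 (x - orth_proj V *m x) <= norm2 x.
Proof.
rewrite -ler_sqr ?nnegrE ?norm2_ge0 // -[leRHS]orth_proj_pythagoras lerDr.
exact: sqr_ge0.
Qed.

Lemma sin_subspace_angle y : norm2 y = 1 ->
  sin (subspace_angle y (orth_proj V)) = norm2 (y - orth_proj V *m y).
Proof.
move=> y1; rewrite /subspace_angle y1 divr1 norm2_orth_proj sin_acos;
  last first.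
  rewrite -{2}y1 norm2_trmx_isometry_le andbT.
  by rewrite (le_trans _ (norm2_ge0 _)) // lerN10.
have := orth_proj_pythagoras y; rewrite y1 expr1n addrC.
by move=> /(canRL (addrK _)) <-; rewrite sqrtr_sqr ger0_norm ?norm2_ge0.
Qed.

Lemma cos_subspace_angle y : norm2 y = 1 ->
  Num.sqrt (1 - norm2 (y - orth_proj V *m y) ^+ 2) = norm2 (V^T *m y).
Proof.
move=> y1; have := orth_proj_pythagoras y; rewrite y1 expr1n.
by move=> /(canRL (addrK _)) <-; rewrite sqrtr_sqr ger0_norm ?norm2_ge0.
Qed.

Lemma norm2_compression_le (M : 'M[R]_m) x :
  norm2 (V^T *m M *m V *m x) <= opnorm2 M * norm2 x.
Proof.
rewrite -!mulmxA; apply: le_trans (norm2_trmx_isometry_le _) _.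
by apply: le_trans (norm2_mulmx_le _ _) _; rewrite norm2_isometry.
Qed.

End OrthogonalProjection.

(** * Determinants under a rank-one deflation *)

Section Deflation.

(** Two eliminations of the bordered matrix (1, -c; z, a) give its determinant:
    clearing z by row operations leaves the Schur complement a + z c, and
    clearing it by column operations leaves a + c z.  The factor a on the left
    makes the identity free of division, so that it can be used over a
    polynomial ring. *)
Lemma mul_det_rank1_update (F : comNzRingType) k (a : F) (z : 'cV[F]_k)
    (c : 'rV[F]_k) :
  a * \det (a%:M + z *m c) = a ^+ k * (a + (c *m z) 0 0).
Proof.
pose B := block_mx 1%:M (- c) z a%:M.
have detB : \det B = \det (a%:M + z *m c).
  suff -> : B = block_mx 1%:M 0 z 1%:M *m block_mx 1%:M (- c) 0 (a%:M + z *m c).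
    by rewrite det_mulmx det_lblock det_ublock !det1 !mul1r.
  rewrite mulmx_block !mul1mx !mul0mx !addr0 mulmx1 mulmxN.
  by rewrite addrCA addNr addr0.
transitivity (\det (B *m block_mx a%:M 0 (- z) 1%:M)).
  by rewrite det_mulmx detB det_lblock det1 det_scalar expr1 mulr1 mulrC.
rewrite mulmx_block !mulmx1 !mulmx0 !add0r mul1mx mulmxN mulNmx opprK.
rewrite mul_mx_scalar mul_scalar_mx scalerN subrr det_ublock det_scalar mulrC.
by congr (_ * _); rewrite [X in \det X]mx11_scalar det_scalar expr1 !mxE eqxx.
Qed.

Lemma det_eigen_update (F : idomainType) k (C : 'M[F]_k) (z : 'cV[F]_k)
    (c : 'rV[F]_k) a s :
  a != 0 -> C *m z = a *: z -> c *m z = 1%:M ->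
  a * \det (C + s *: (z *m c)) = \det C * (a + s).
Proof.
move=> a0 Cz cz.
have -> : a + s = a + ((s *: c) *m z) 0 0 by rewrite -scalemxAl cz !mxE mulr1.
apply: (mulfI (expf_neq0 k a0)); rewrite [RHS]mulrCA -mul_det_rank1_update.
rewrite [LHS]mulrCA [RHS]mulrCA -detZ -det_mulmx; congr (a * \det _).
by rewrite mulmxDr mulmxA Cz mul_mx_scalar -scalemxAl -scalemxAr scalerDr.
Qed.

(** Deflation: a rank-one update along an eigenvector z moves its eigenvalue and
    leaves the others in place, whatever the row c normalised by c z = 1.  Both
    sides keep a linear factor so as to avoid dividing polynomials. *)
Lemma char_poly_deflation (F : idomainType) k (H : 'M[F]_k) (z : 'cV[F]_k)
    (c : 'rV[F]_k) mu s :
  H *m z = mu *: z -> c *m z = 1%:M ->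
  ('X - mu%:P) * char_poly (H - s *: (z *m c))
    = char_poly H * ('X - (mu - s)%:P).
Proof.
move=> Hz cz; rewrite [(mu - s)%:P]polyCB opprB addrA addrAC.
rewrite -(@det_eigen_update _ _ _ (map_mx polyC z) (map_mx polyC c)).
- congr (_ * \det _); rewrite /char_poly_mx map_mxB map_mxZ map_mxM.
  by rewrite opprB addrCA addrC.
- by rewrite polyXsubC_eq0.
- by rewrite mulmxBl -map_mxM Hz map_mxZ mul_scalar_mx scalerBl.
- by rewrite -map_mxM cz map_mx1.
Qed.

Lemma horner_char_poly (F : comNzRingType) k (H : 'M[F]_k) t :
  (char_poly H).[t] = \det (t%:M - H).
Proof.
rewrite -horner_evalE -det_map_mx map_mxB map_scalar_mx /= horner_evalE hornerX.
by congr (\det (_ - _)); apply/matrixP=> i j; rewrite !mxE horner_evalE hornerC.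
Qed.

End Deflation.

(** * Inverses bounded through the adjugate *)

Section AdjugateBound.
Context {R : realType}.

Lemma norm_det_le k (T : 'M[R]_k) b :
  (forall i j, `|T i j| <= b) -> `|\det T| <= k`!%:R * b ^+ k.
Proof.
move=> Tb; apply: le_trans (ler_norm_sum _ _ _) _.
have -> : k`!%:R * b ^+ k = \sum_(s : 'S_k) b ^+ k.
  by rewrite sumr_const card_Sn mulr_natl.
apply: ler_sum => s _; rewrite normrM normrX normrN1 expr1n mul1r normr_prod.
have -> : b ^+ k = \prod_(i < k) b by rewrite prodr_const card_ord.
apply: ler_prod => i _.
by rewrite normr_ge0 Tb.
Qed.

(** A matrix with bounded entries and a determinant away from 0 has a bounded
    inverse, since its adjugate is bounded entrywise; stated without the
    inverse, so that no invertibility has to be assumed. *)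
Lemma norm_det_mulmx_le k (T : 'M[R]_k) b (w : 'cV[R]_k) :
  (forall i j, `|T i j| <= b) ->
  `|\det T| * norm2 w
    <= k%:R * k%:R * (k.-1`!%:R * b ^+ k.-1) * norm2 (T *m w).
Proof.
move=> Tb; rewrite -norm2Z -mul_scalar_mx -mul_adj_mx -mulmxA.
apply: norm2_mulmx_entries => i j; rewrite mxE /cofactor normrM normrX normrN1.
rewrite expr1n mul1r; apply: norm_det_le => i' j'; rewrite !mxE; exact: Tb.
Qed.

End AdjugateBound.

(** * Simple and separated eigenvalues *)

Section SimpleEigenvalue.
Context {R : realType}.

Lemma simple_char_poly_factor k (H : 'M[R]_k) mu : simple_eigenvalue H mu ->
  exists2 q, char_poly H = q * ('X - mu%:P) & q.[mu] != 0.
Proof.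
move=> sH; have pH0 : char_poly H != 0 by rewrite monic_neq0 ?char_poly_monic.
have : 'X - mu%:P %| char_poly H by rewrite XsubC_dvd // sH.
rewrite dvdp_XsubCl => /factor_theorem [q pE]; exists q => //.
apply/negP => /factor_theorem [q' qE].
have : (mup mu (char_poly H) < 2)%N by rewrite sH.
by rewrite mup_ltn // pE qE -mulrA -expr2 dvdp_mull.
Qed.

(** If u were orthogonal to z, deflating H along z would leave u as a left
    eigenvector although it removes mu from the spectrum. *)
Lemma simple_eigen_dot_neq0 k (H : 'M[R]_k) mu (u z : 'cV[R]_k) :
  simple_eigenvalue H mu -> norm2 u = 1 -> norm2 z = 1 ->
  u^T *m H = mu *: u^T -> H *m z = mu *: z -> dotv u z != 0.
Proof.
move=> sH u1 z1 uH Hz; apply/eqP => uz.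
have uz0 : u^T *m z = 0 by apply/matrixP => i j; rewrite !ord1 -dotvE uz mxE.
have zz : z^T *m z = 1%:M.
  by rewrite [LHS]mx11_scalar -dotvE -sqr_norm2 z1 expr1n.
have [q pE qmu] := simple_char_poly_factor sH.
have := char_poly_deflation 1 Hz zz; rewrite pE -mulrA mulrCA.
move=> /(mulfI (negbT (polyXsubC_eq0 _))) pB.
have : root (char_poly (H - 1 *: (z *m z^T))) mu.
  rewrite -eigenvalue_root_char; apply/eigenvalueP; exists u^T.
    by rewrite mulmxBr scale1r mulmxA uz0 mul0mx subr0.
  rewrite -trmx0 (inj_eq (can_inj (@trmxK _ _ _))) -norm2_eq0 u1.
  exact: oner_neq0.
rewrite pB rootM /root (negbTE qmu) hornerXsubC opprB addrC subrK.
by rewrite oner_eq0.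
Qed.

Lemma norm_horner_prod_ge (F : numDomainType) (rs : seq F) (x c : F) : 0 <= c ->
  (forall z, z \in rs -> c <= `|z - x|) ->
  c ^+ size rs <= `|(\prod_(z <- rs) ('X - z%:P)).[x]|.
Proof.
move=> c0; elim: rs => [|z rs IH] rsc.
  by rewrite big_nil hornerC normr1.
rewrite big_cons hornerM normrM hornerXsubC exprS distrC ler_pM ?exprn_ge0 //.
  by rewrite rsc ?mem_head.
by apply: IH => t trs; rewrite rsc // inE trs orbT.
Qed.

(** Over the complex numbers q splits into linear factors, each of which is at
    least d in modulus at nu. *)
Lemma cofactor_poly_lower_bound k (H : 'M[R]_k) mu nu d q :
  char_poly H = q * ('X - mu%:P) -> q.[mu] != 0 -> 0 < d ->
  other_eigenvalues_apart H mu nu d -> d ^+ k.-1 <= `|q.[nu]|.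
Proof.
move=> pE qmu d0 apartH; pose f := @real_complex R.
have [rs /= qC] := closed_field_poly_normal (map_poly f q).
have mq : q \is monic.
  by rewrite -(monicMr q (monicXsubC mu)) -pE char_poly_monic.
have szq : size q = k.-1.+1.
  have := size_char_poly H; rewrite pE size_Mmonic ?monicXsubC ?monic_neq0 //.
  rewrite size_XsubC addn2 /= => -[<-].
  by rewrite prednK // size_poly_gt0 monic_neq0.
have lq : lead_coef (map_poly f q) = 1.
  by rewrite lead_coef_map (monicP mq) rmorph1.
rewrite lq scale1r in qC.
have szr : size rs = k.-1.
  by apply: succn_inj; rewrite -szq -(size_map_poly f) qC size_prod_XsubC.
have rsP z : z \in rs -> f d <= `|z - f nu|.
  move=> zrs; have rz : root (map_poly f q) z by rewrite qC root_prod_XsubC.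
  apply: apartH; last first.
    by apply: contraNneq qmu => zmu; rewrite zmu fmorph_root in rz.
  by rewrite eigenvalue_root_char -map_char_poly pE rmorphM rootM rz.
have f0 : 0 <= f d by rewrite lecR ltW.
have := norm_horner_prod_ge f0 rsP.
rewrite -qC szr horner_map -rmorphXn /= normc_def /= expr0n /= addr0 sqrtr_sqr.
by rewrite lecR.
Qed.

End SimpleEigenvalue.

(** * First-order perturbation of a simple eigenvalue *)

Section RitzValue.
Context {R : realType}.

(** A bound for the inverse of H - nu on the invariant complement of the
    eigenvector, times the bound 1 + kbar for the projection onto it: the power
    is the cofactor bound for the deflated matrix nu - B, whose entries are at
    most the base of that power, and d ^+ k.-1 bounds its determinant below. *)
Definition separation_const (k : nat) (N nu d kbar : R) : R :=
  k%:R * k%:R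
    * (k.-1`!%:R * (`|nu| + N + (N + `|nu| + 1) * kbar) ^+ k.-1)
    * (1 + kbar) / d ^+ k.-1.

Lemma separation_const_ge0 k N nu d kbar : 0 <= N -> 0 < d -> 0 <= kbar ->
  0 <= separation_const k N nu d kbar.
Proof.
move=> N0 d0 kb0; have b0 : 0 <= `|nu| + N + (N + `|nu| + 1) * kbar.
  by rewrite addr_ge0 ?mulr_ge0 ?addr_ge0.
apply: divr_ge0; last by rewrite exprn_ge0 ?ltW.
have kb1 : 0 <= 1 + kbar by rewrite addr_ge0.
by rewrite !mulr_ge0 ?exprn_ge0.
Qed.

Lemma norm_entry_mulmx_le k (H : 'M[R]_k) N i j :
  (forall v, norm2 (H *m v) <= N * norm2 v) -> `|H i j| <= N.
Proof.
move=> HN; have := HN (delta_mx j 0); rewrite -colE.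
have -> : norm2 (delta_mx j 0 : 'cV[R]_k) = 1.
  rewrite /norm2 /dotv (bigD1 j) //= big1 => [|i' /negPf i'j].
    by rewrite addr0 mxE !eqxx mulr1 sqrtr1.
  by rewrite mxE i'j mul0r.
rewrite mulr1; apply: le_trans.
by have := norm_entry_le (col j H) i; rewrite mxE.
Qed.

(** If x has a small residual for nu then, up to a second-order term, mu lies
    within kappa times the residual of nu.  Testing the residual against the
    left eigenvector gives the factor kappa; the subtracted term bounds the
    part of x outside the eigenline, by deflation. *)
Lemma ritz_value_distance k (H : 'M[R]_k) (mu nu d N kappa kbar : R)
    (x : 'cV[R]_k) :
  0 < d -> simple_eigenvalue H mu -> eigenvalue_condition H mu kappa ->
  kappa <= kbar -> other_eigenvalues_apart H mu nu d ->
  (forall v, norm2 (H *m v) <= N * norm2 v) ->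
  (norm2 x - separation_const k N nu d kbar * norm2 ((H - nu%:M) *m x))
    * `|mu - nu| <= kappa * norm2 ((H - nu%:M) *m x).
Proof.
move=> d0 sH [u [z [u1 z1 uH Hz kappaE]]] kk apartH HN.
have t0 := simple_eigen_dot_neq0 sH u1 z1 uH Hz.
set t := dotv u z in t0 kappaE; set r := (H - nu%:M) *m x.
have kappa0 : 0 <= kappa by rewrite kappaE invr_ge0.
have tu v : t^-1 *: u^T *m v = (t^-1 * dotv u v)%:M.
  by rewrite -scalemxAl [u^T *m v]mx11_scalar -dotvE scale_scalar_mx.
pose a := t^-1 * dotv u x; pose w := x - a *: z.
have cz : (t^-1 *: u^T) *m z = 1%:M by rewrite tu mulVf.
have cw : (t^-1 *: u^T) *m w = 0.
  by rewrite mulmxBr -scalemxAr cz tu scalemx1 subrr.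
have mua : a * (mu - nu) = t^-1 * dotv u r.
  rewrite dotvE mulmxA mulmxBr uH mul_mx_scalar -scalerBl -scalemxAl mxE -dotvE.
  by rewrite /a; ring.
have mua_le : `|a| * `|mu - nu| <= kappa * norm2 r.
  rewrite -normrM mua normrM normfV -kappaE ler_wpM2l //.
  by apply: le_trans (norm_dotv_le _ _) _; rewrite u1 mul1r.
apply: le_trans (mua_le); rewrite ler_wpM2r // lerBlDr.
have xE : x = a *: z + w by rewrite /w addrC subrK.
rewrite {1}xE; apply: le_trans (norm2D _ _) _.
rewrite norm2Z z1 mulr1 lerD2l /separation_const mulrAC.
rewrite ler_pdivlMr ?exprn_gt0 //.
(* This shift moves the eigenvalue mu of H to nu - 1, so that it contributes
   the factor 1 to the determinant at nu. *)
pose s := mu - nu + 1; pose B := H - s *: (z *m (t^-1 *: u^T)).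
have [q pE qmu] := simple_char_poly_factor sH.
have detB : \det (nu%:M - B) = q.[nu].
  have := char_poly_deflation s Hz cz; rewrite pE -mulrA mulrCA.
  move=> /(mulfI (negbT (polyXsubC_eq0 _))).
  rewrite -horner_char_poly => ->; rewrite hornerM hornerXsubC /s.
  by rewrite -[RHS]mulr1; congr (_ * _); ring.
have mu_le : `|mu| <= N.
  by have := HN z; rewrite Hz norm2Z z1 !mulr1.
have N0 : 0 <= N by apply: le_trans mu_le.
have kb0 : 0 <= kbar by apply: le_trans kk.
have s_le : `|s| <= N + `|nu| + 1.
  apply: le_trans (ler_normD _ _) _; rewrite normr1 lerD2r.
  by apply: le_trans (ler_normB _ _) _; rewrite lerD2r.
have entB i j : `|(nu%:M - B) i j| <= `|nu| + N + (N + `|nu| + 1) * kbar.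
  have -> : (nu%:M - B) i j
      = (nu%:M : 'M_k) i j - H i j + s * (z i 0 * (t^-1 * u j 0)).
    by rewrite !mxE big_ord1 !mxE; ring.
  apply: le_trans (ler_normD _ _) _; apply: lerD.
    apply: le_trans (ler_normB _ _) _; apply: lerD.
      by rewrite mxE; case: (i == j); rewrite ?mulr1n // mulr0n normr0.
    exact: norm_entry_mulmx_le.
  rewrite normrM ler_pM //; apply: le_trans kk.
  rewrite mulrCA normrM normfV -kappaE ler_piMr // normrM.
  rewrite mulr_ile1 //; first by rewrite -z1 norm_entry_le.
  by rewrite -u1 norm_entry_le.
rewrite mulrC.
apply: (@le_trans _ _ (`|\det (nu%:M - B)| * norm2 w)).
  rewrite detB ler_wpM2r ?norm2_ge0 //.
  exact: (cofactor_poly_lower_bound pE qmu d0 apartH).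
apply: le_trans (norm_det_mulmx_le _ entB) _; rewrite -!mulrA.
rewrite !ler_wpM2l ?exprn_ge0 ?addr_ge0 ?mulr_ge0 ?addr_ge0 //.
have -> : (nu%:M - B) *m w = a *: ((mu - nu) *: z) - r.
  rewrite /B opprB addrCA mulmxDl -scalemxAl -mulmxA cw mulmx0 scaler0 add0r.
  rewrite -[nu%:M - H]opprB mulNmx /w mulmxBr opprB -scalemxAr mulmxBl Hz.
  by rewrite mul_scalar_mx -scalerBl.
apply: le_trans (norm2B _ _) _; rewrite !norm2Z z1 mulr1 mulrDl mul1r addrC.
by rewrite lerD2l (le_trans mua_le) // ler_wpM2r ?norm2_ge0.
Qed.

End RitzValue.

(** * The trust-region matrix *)

Section TrustRegion.
Context {R : realType} {n : nat}.
Implicit Types A B : 'M[R]_n.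

Lemma not_unit_left_kernel B :
  B \notin unitmx -> exists2 v : 'rV[R]_n, v *m B = 0 & v != 0.
Proof.
rewrite -row_free_unit -kermx_eq0 => /rowV0Pn [v /sub_kermxP vB v0].
by exists v.
Qed.

Lemma norm2_tr_gt0 (v : 'rV[R]_n) : v != 0 -> 0 < norm2 v^T.
Proof.
by move=> v0; rewrite lt_def norm2_ge0 andbT norm2_eq0 trmx_eq0.
Qed.

Lemma psd_left_eigen_ge0 B (v : 'rV[R]_n) a :
  psd B -> v *m B = a *: v -> v != 0 -> 0 <= a.
Proof.
move=> psdB vB v0; have := psdB v^T.
rewrite dotvE trmxK mulmxA vB -scalemxAl mxE -{1}[v]trmxK -dotvE -sqr_norm2.
by rewrite pmulr_lge0 // exprn_gt0 // norm2_tr_gt0.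
Qed.

Lemma psd_shift_unit B c : psd B -> 0 < c -> B + c%:M \in unitmx.
Proof.
move=> psdB c0; apply/negPn/negP => /not_unit_left_kernel [v vB v0].
have vB' : v *m B = (- c) *: v.
  by apply/eqP; rewrite scaleNr -addr_eq0 -mul_mx_scalar -mulmxDr vB.
by have := psd_left_eigen_ge0 psdB vB' v0; rewrite oppr_ge0 leNgt c0.
Qed.

(** A kernel vector of the positive semidefinite matrix A + lam would make -lam
    the smallest eigenvalue of A; and g = - (A + lam) s is orthogonal to that
    kernel, which is what the easy case excludes. *)
Lemma easy_case_unit A (g s : 'cV[R]_n) Delta lam :
  A^T = A -> optimal_multiplier A g Delta s lam -> easy_case A g lam ->
  A + lam%:M \in unitmx.
Proof.
move=> symA [_ sE _ psdA] easy.
apply/negPn/negP => /not_unit_left_kernel [v vA v0].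
apply: (easy (- lam)); last first.
  split; last by rewrite opprK.
  move=> x Ax; apply/eqP; rewrite -oppr_eq0 -(opprK g) -sE dotvC dotvNr opprK.
  rewrite dotvC dotv_mulmxl linearD /= symA tr_scalar_mx mulmxDl Ax.
  by rewrite mul_scalar_mx scaleNr addNr dotvE mulmx0 mxE.
split.
  apply/eigenvalueP; exists v => //.
  by apply/eqP; rewrite scaleNr -addr_eq0 -mul_mx_scalar -mulmxDr vA.
move=> beta /eigenvalueP [x xA x0]; rewrite -subr_ge0 opprK.
apply: (psd_left_eigen_ge0 psdA _ x0).
by rewrite mulmxDr xA mul_mx_scalar scalerDl.
Qed.

(** With s the trust-region solution and y2 = (A + lam I)^-1 s, the row vector
    (y2^T, s^T) is a left eigenvector of M, because
    g^T y2 = - s^T s = - Delta^2. *)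
Lemma multiplier_eigenvalue A (g s : 'cV[R]_n) Delta lam :
  A^T = A -> 0 < Delta -> norm2 s = Delta ->
  optimal_multiplier A g Delta s lam -> A + lam%:M \in unitmx ->
  eigenvalue (trs_mx A g Delta) lam.
Proof.
move=> symA D0 sD [_ sE _ _] uA.
have symB : (A + lam%:M)^T = A + lam%:M by rewrite linearD /= symA tr_scalar_mx.
pose y2 := invmx (A + lam%:M) *m s.
have By2 : (A + lam%:M) *m y2 = s by rewrite mulmxA mulmxV // mul1mx.
have y2B : y2^T *m (A + lam%:M) = s^T.
  by rewrite -[A + _]symB -trmx_mul By2.
have sB : s^T *m (A + lam%:M) = - g^T.
  by rewrite -[A + _]symB -trmx_mul sE linearN.
have y2g : y2^T *m g = (- Delta ^+ 2)%:M.
  rewrite -[g]opprK -sE mulmxN mulmxA y2B [_ *m s]mx11_scalar -dotvE -sqr_norm2.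
  by rewrite sD raddfN.
have D20 : Delta ^+ 2 != 0 by rewrite expf_neq0 ?gt_eqF.
apply/eigenvalueP; exists (row_mx y2^T s^T); last first.
  apply/negP => /eqP; rewrite -row_mx0 => /eq_row_mx [_ s0].
  have : norm2 s == 0 by rewrite norm2_eq0 -trmx_eq0 s0.
  by rewrite sD gt_eqF.
rewrite /trs_mx mul_row_block scale_row_mx !mulmxN mulmx1; congr row_mx.
  by rewrite -y2B mulmxDr mul_mx_scalar addrA addNr add0r.
rewrite -scalemxAr mulmxA y2g mul_scalar_mx scalerA mulrN mulVf // scaleN1r.
by rewrite -sB mulmxDr mul_mx_scalar addrAC addrN add0r.
Qed.

(** As lam is an eigenvalue of M, the rightmost one is at least lam; the
    inequality is enough, since shifting A + lam further keeps it invertible. *)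
Lemma shifted_mx_unit A (g s : 'cV[R]_n) Delta lam mu :
  A^T = A -> 0 < Delta -> norm2 s = Delta ->
  optimal_multiplier A g Delta s lam -> easy_case A g lam ->
  rightmost_eigenvalue (trs_mx A g Delta) mu -> A + mu%:M \in unitmx.
Proof.
move=> symA D0 sD opt easy [_ right].
have uA := easy_case_unit symA opt easy.
have := multiplier_eigenvalue symA D0 sD opt uA.
rewrite -(eigenvalue_map (real_complex R)) => /right /=.
rewrite le_eqVlt => /predU1P [<- //|lam_mu].
have -> : A + mu%:M = (A + lam%:M) + (mu - lam)%:M.
  by rewrite -addrA -raddfD /= [lam + _]addrC subrK.
by apply: psd_shift_unit; [case: opt | rewrite subr_gt0].
Qed.

Lemma unitmx_lower_bound B : B \in unitmx ->
  exists2 c, 0 < c & forall x, c * norm2 x <= norm2 (B *m x).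
Proof.
move=> uB; have b0 := opnorm2_ge0 (invmx B).
have b1 : 0 < 1 + opnorm2 (invmx B) by rewrite ltr_pwDl.
exists (1 + opnorm2 (invmx B))^-1; first by rewrite invr_gt0.
move=> x; rewrite mulrC ler_pdivrMr // mulrC -{1}[x]mul1mx -(mulVmx uB) -mulmxA.
apply: le_trans (norm2_mulmx_le _ _) _.
by rewrite ler_wpM2r ?norm2_ge0 // lerDr.
Qed.

Lemma sqr_norm2_split (v : 'cV[R]_(n + n)) :
  norm2 v ^+ 2 = norm2 (usubmx v) ^+ 2 + norm2 (dsubmx v) ^+ 2.
Proof.
rewrite !sqr_norm2 /dotv big_split_ord /=.
by congr (_ + _); apply: eq_bigr => i _; rewrite !mxE.
Qed.

Lemma norm2_usubmx_le (v : 'cV[R]_(n + n)) : norm2 (usubmx v) <= norm2 v.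
Proof.
by rewrite -ler_sqr ?nnegrE ?norm2_ge0 // sqr_norm2_split lerDl sqr_ge0.
Qed.

Lemma norm2_dsubmx_le (v : 'cV[R]_(n + n)) : norm2 (dsubmx v) <= norm2 v.
Proof.
by rewrite -ler_sqr ?nnegrE ?norm2_ge0 // sqr_norm2_split lerDr sqr_ge0.
Qed.

Lemma norm2_le_split (v : 'cV[R]_(n + n)) :
  norm2 v <= norm2 (usubmx v) + norm2 (dsubmx v).
Proof.
rewrite -ler_sqr ?nnegrE ?addr_ge0 ?norm2_ge0 // sqr_norm2_split sqrrD.
by rewrite lerD2r lerDl mulrn_wge0 // mulr_ge0 ?norm2_ge0.
Qed.

Lemma trs_mx_sub_mul A (g : 'cV[R]_n) Delta mu (v : 'cV[R]_(n + n)) :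
  (trs_mx A g Delta - mu%:M) *m v
    = col_mx (((Delta ^+ 2)^-1 * dotv g (dsubmx v)) *: g
                - (A + mu%:M) *m usubmx v)
             (usubmx v - (A + mu%:M) *m dsubmx v).
Proof.
rewrite -{1}[v]vsubmxK mulmxBl /trs_mx mul_block_col [mu%:M *m _]mul_scalar_mx.
rewrite scale_col_mx opp_col_mx add_col_mx; congr col_mx.
  rewrite -scalemxAl -mulmxA [g^T *m _]mx11_scalar -dotvE mul_mx_scalar scalerA.
  by rewrite mulmxDl mul_scalar_mx mulNmx opprD addrA [X in X - _]addrC.
by rewrite mul1mx mulmxDl mul_scalar_mx mulNmx opprD addrA.
Qed.

(** The first block of (M - mu) v is, up to the scaling that turns v into s,
    the residual of s. *)
Lemma trs_residual_le A (g : 'cV[R]_n) Delta mu (v : 'cV[R]_(n + n)) :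
  0 < Delta -> dotv g (dsubmx v) != 0 ->
  norm2 ((A + mu%:M) *m (- (Delta ^+ 2 / dotv g (dsubmx v)) *: usubmx v) + g)
    <= `|Delta ^+ 2 / dotv g (dsubmx v)|
         * norm2 ((trs_mx A g Delta - mu%:M) *m v).
Proof.
move=> D0 g0; set t := Delta ^+ 2 / _.
have D20 : Delta ^+ 2 != 0 by rewrite expf_neq0 ?gt_eqF.
have -> : (A + mu%:M) *m (- t *: usubmx v) + g
    = t *: usubmx ((trs_mx A g Delta - mu%:M) *m v).
  rewrite trs_mx_sub_mul col_mxKu scalerBr scalerA -scalemxAr scaleNr addrC.
  congr (_ - _); rewrite -[LHS]scale1r; congr (_ *: _); rewrite /t.
  by field; rewrite g0 gt_eqF.
by rewrite norm2Z ler_wpM2l // norm2_usubmx_le.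
Qed.

(** A vector with a small residual cannot have a small first block: the second
    block row of M - mu then forces (A + nu) times the second block to be
    small too. *)
Lemma first_block_lower_bound A (g : 'cV[R]_n) Delta nu mu c
    (v : 'cV[R]_(n + n)) :
  norm2 v = 1 -> 0 < c -> (forall x, c * norm2 x <= norm2 ((A + nu%:M) *m x)) ->
  c <= (1 + c) * norm2 (usubmx v) + norm2 ((trs_mx A g Delta - mu%:M) *m v)
         + `|mu - nu|.
Proof.
move=> v1 c0 Bc.
have u2 : norm2 (dsubmx v) <= 1 by rewrite -v1 norm2_dsubmx_le.
have u12 : 1 <= norm2 (usubmx v) + norm2 (dsubmx v).
  by rewrite -v1 norm2_le_split.
set rho := norm2 (_ *m v).
have r2 : norm2 (usubmx v - (A + mu%:M) *m dsubmx v) <= rho.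
  apply: le_trans (norm2_dsubmx_le _).
  by rewrite trs_mx_sub_mul col_mxKd.
have : norm2 ((A + nu%:M) *m dsubmx v)
    <= norm2 (usubmx v) + rho + `|mu - nu| * norm2 (dsubmx v).
  have -> : (A + nu%:M) *m dsubmx v = usubmx v
      - (usubmx v - (A + mu%:M) *m dsubmx v) - (mu - nu) *: dsubmx v.
    rewrite opprB addrCA addrN addr0 -mul_scalar_mx -mulmxBl.
    by rewrite -addrA -raddfB /= opprB [mu + _]addrC subrK.
  apply: le_trans (norm2B _ _) _; rewrite norm2Z lerD2r.
  by apply: le_trans (norm2B _ _) _; rewrite lerD2l.
have := Bc (dsubmx v); have m0 := normr_ge0 (mu - nu).
have := ler_wpM2l m0 u2; have := ler_wpM2l (ltW c0) u12.
by move: (norm2 (dsubmx v)) (norm2 (usubmx v)) (`|_|) => y2 y1 m; nra.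
Qed.

End TrustRegion.

(** * Residuals of projected and refined vectors *)

Section RefinedRitz.
Context {R : realType} {m k : nat} (V : 'M[R]_(m, k)).
Hypothesis orthoV : orthonormal_cols V.
Implicit Types (M : 'M[R]_m) (y v : 'cV[R]_m).

(** The compression sees the eigenvector equation only through P: the error
    P M (y - P y) is the coupling between the subspace and its complement. *)
Lemma compression_residual_le M y mu : M *m y = mu *: y ->
  norm2 ((V^T *m M *m V - mu%:M) *m (V^T *m y))
    <= opnorm2 (orth_proj V *m M *m (1%:M - orth_proj V))
         * norm2 (y - orth_proj V *m y).
Proof.
move=> My; have -> : (V^T *m M *m V - mu%:M) *m (V^T *m y)
    = - (V^T *m (M *m (y - orth_proj V *m y))).
  rewrite !mulmxBl !mulmxBr opprB My mul_scalar_mx -scalemxAr /orth_proj.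
  by rewrite -!mulmxA.
have PP : orth_proj V *m (orth_proj V *m y) = orth_proj V *m y.
  by rewrite /orth_proj -!mulmxA [V^T *m (V *m _)]mulmxA orthoV mul1mx.
have compl : (1%:M - orth_proj V) *m (y - orth_proj V *m y)
    = y - orth_proj V *m y.
  by rewrite mulmxBl mul1mx mulmxBr PP subrr subr0.
rewrite norm2N -norm2_orth_proj // -{1}compl !mulmxA.
exact: norm2_mulmx_le.
Qed.

Lemma coupling_opnorm_le M :
  opnorm2 (orth_proj V *m M *m (1%:M - orth_proj V)) <= opnorm2 M.
Proof.
apply: opnorm2_le => [|x x1]; first exact: opnorm2_ge0.
rewrite -2!mulmxA norm2_orth_proj //.
apply: le_trans (norm2_trmx_isometry_le orthoV _) _.
apply: le_trans (norm2_mulmx_le _ _) _.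
rewrite ler_piMr ?opnorm2_ge0 // mulmxBl mul1mx -x1.
exact: norm2_orth_compl_le.
Qed.

Lemma opnorm2_shift_le M mu : opnorm2 (M - mu%:M) <= opnorm2 M + `|mu|.
Proof.
apply: opnorm2_le => [|x x1]; first by rewrite addr_ge0 ?opnorm2_ge0.
rewrite mulmxBl mul_scalar_mx; apply: le_trans (norm2B _ _) _.
rewrite norm2Z x1 mulr1 lerD2r; apply: le_trans (norm2_mulmx_le _ _) _.
by rewrite x1 mulr1.
Qed.

(** The normalised projection of y is a competitor in the minimisation that
    defines the refined Ritz vector. *)
Lemma refined_residual_le v M mu x y :
  (V^T == krylov_mx k v M)%MS -> refined_ritz_vector k v M mu x ->
  norm2 (V^T *m y) * norm2 ((M - mu%:M) *m x)
    <= norm2 ((M - mu%:M) *m (orth_proj V *m y)).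
Proof.
move=> /andP[VK _] [_ _ xmin].
have [->|y0] := eqVneq (norm2 (V^T *m y)) 0; first by rewrite mul0r norm2_ge0.
have n0 : 0 < norm2 (V^T *m y) by rewrite lt_def y0 norm2_ge0.
have n0' : `|(norm2 (V^T *m y))^-1| = (norm2 (V^T *m y))^-1.
  by rewrite gtr0_norm // invr_gt0.
rewrite mulrC -ler_pdivlMr // mulrC -n0' -norm2Z scalemxAr; apply: xmin.
  rewrite /in_krylov linearZ /= scalemx_sub //.
  apply: submx_trans VK; rewrite -mulmxA trmx_mul; exact: submxMl.
by rewrite norm2Z norm2_orth_proj // n0' mulVf.
Qed.

Lemma proj_residual_le M mu nu y : norm2 y = 1 -> M *m y = nu *: y ->
  norm2 ((M - mu%:M) *m (orth_proj V *m y))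
    <= `|mu - nu| + opnorm2 (M - mu%:M) * norm2 (y - orth_proj V *m y).
Proof.
move=> y1 My; have -> : (M - mu%:M) *m (orth_proj V *m y)
    = (nu - mu) *: y - (M - mu%:M) *m (y - orth_proj V *m y).
  have Ey : (M - mu%:M) *m y = (nu - mu) *: y.
    by rewrite mulmxBl My mul_scalar_mx scalerBl.
  by rewrite [in RHS]mulmxBr Ey opprB addrCA subrr addr0.
apply: le_trans (norm2B _ _) _; rewrite norm2Z y1 mulr1 distrC lerD2l.
exact: norm2_mulmx_le.
Qed.

End RefinedRitz.

(** * The error bound *)

(** The bookkeeping of the second-order terms: m is the Ritz value error, e the
    sine of the angle and co its cosine, G the coupling norm gamma, L the norm
    of the shifted matrix, rho the refined residual and b the norm of the first
    block.  The first bound on e makes both co and co - K (G e) at least 1/2, the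
    second one makes b at least c / (2 (1 + c)). *)
Lemma residual_bookkeeping (R : realType)
    (N K kb c Delta e co m kappa G L rho b lhs : R) :
  0 <= N -> 0 <= K -> 0 <= kb -> 0 < c -> 0 < Delta ->
  0 <= e -> 1 - e <= co -> 0 <= m -> 0 <= kappa <= kb -> 0 <= G <= N ->
  0 <= L <= N + N -> 0 < b ->
  (co - K * (G * e)) * m <= kappa * (G * e) ->
  co * rho <= m + L * e ->
  lhs <= Delta / b * rho ->
  c <= (1 + c) * b + rho + m ->
  e <= (1 + K * N)^-1 / 2 ->
  e <= c / (2 * (6 * kb * N + 4 * N + 1)) ->
  lhs <= (L + kappa * G) * Delta / (b * co) * e
    + 8 * Delta * (1 + c) * (1 + K * N) * kb * N / c * e ^+ 2.
Proof.
move=> N0 K0 kb0 c0 D0 e0 coe m0 /andP[k0 kk] /andP[G0 GN] /andP[L0 LN] b0.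
move=> F1 F2 F3 F4 eK eQ.
have KN1 : 0 < 1 + K * N by rewrite ltr_pwDl // mulr_ge0.
have {}eK : (1 + K * N) * e <= 1 / 2.
  by rewrite mulrC -ler_pdivlMr // mul1r mulrC.
have Q0 : 0 < 6 * kb * N + 4 * N + 1.
  by rewrite ltr_wpDl // addr_ge0 // !mulr_ge0.
have {}eQ : (6 * kb * N + 4 * N + 1) * e <= c / 2.
  by move: eQ; rewrite ler_pdivlMr ?mulr_gt0 // => eQ; lra.
have KG : K * (G * e) <= K * N * e.
  by rewrite -mulrA ler_wpM2l // ler_wpM2r.
have kG : kappa * (G * e) <= kb * N * e.
  by rewrite mulrA ler_wpM2r // ler_pM.
have co2 : 1 / 2 <= co.
  by have := mulr_ge0 (mulr_ge0 K0 N0) e0; lra.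
have co0 : 0 < co by lra.
have lead : 1 - (1 + K * N) * e <= co - K * (G * e) by lra.
have F1' := le_trans (ler_wpM2r m0 lead) F1.
have m_le : m <= 2 * (kb * N * e).
  have : (1 / 2) * m <= (1 - (1 + K * N) * e) * m by rewrite ler_wpM2r //; lra.
  lra.
have m_fine : m <= kappa * G * e + (1 + K * N) * e * (2 * (kb * N * e)).
  have := ler_wpM2l (mulr_ge0 (ltW KN1) e0) m_le; lra.
have rho_le : rho <= 2 * (m + L * e).
  have [r0|r0] := leP rho 0.
    by apply: le_trans r0 _; rewrite mulr_ge0 // addr_ge0 // mulr_ge0.
  have := ler_wpM2r (ltW r0) co2; lra.
have b_le : c / 2 <= (1 + c) * b.
  have := ler_wpM2r e0 LN; lra.
have c1 : 0 < 1 + c by lra.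
have bV : b^-1 <= 2 * (1 + c) / c.
  rewrite -[leRHS]invrK lef_pV2 ?posrE ?invr_gt0 ?divr_gt0 ?mulr_gt0 //.
  by rewrite invf_div ler_pdivrMr ?mulr_gt0 //; lra.
have coV : co^-1 <= 2.
  by rewrite -[leRHS]invrK lef_pV2 ?posrE ?invr_gt0 //; lra.
apply: (le_trans F3).
have rho_co : rho <= (m + L * e) / co by rewrite ler_pdivlMr // mulrC.
apply: (le_trans (ler_wpM2l _ rho_co)); first by rewrite ltW // divr_gt0.
have fine : m + L * e
    <= (L + kappa * G) * e + (1 + K * N) * e * (2 * (kb * N * e)) by lra.
have pos : 0 <= Delta / b / co by rewrite ltW // !divr_gt0.
rewrite mulrA mulrAC; apply: (le_trans (ler_wpM2l pos fine)).
rewrite mulrDr invfM; apply: lerD.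
  by rewrite le_eqVlt; apply/orP; left; apply/eqP; ring.
have S0 : 0 <= (1 + K * N) * e * (2 * (kb * N * e)).
  by rewrite !mulr_ge0 // ltW.
have : Delta / b / co <= Delta * (2 * (1 + c) / c) * 2.
  rewrite ler_pM ?(ltW (divr_gt0 _ _)) ?invr_ge0 ?(ltW co0) //.
  by rewrite ler_wpM2l // ltW.
move=> /(ler_wpM2r S0) /le_trans; apply.
by rewrite le_eqVlt; apply/orP; left; apply/eqP; ring.
Qed.

Theorem theorem5p6 (R : realType) (n k : nat)
    (A : 'M[R]_n) (g : 'cV[R]_n) (Delta : R) (sopt : 'cV[R]_n) (lam mu1 : R)
    (symA : A^T = A) (g_neq0 : g != 0) (Delta_gt0 : 0 < Delta)
    (sopt_sol : trs_solution A g Delta sopt)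
    (sopt_bnd : norm2 sopt = Delta)
    (lam_opt : optimal_multiplier A g Delta sopt lam)
    (easy : easy_case A g lam)
    (mu1_right : rightmost_eigenvalue (trs_mx A g Delta) mu1) :
  let M := trs_mx A g Delta in
  (* kbar and d range over bounds on the spectral data of H_k on which the
     constant of the second-order remainder may depend *)
  forall (kbar d : R), 0 < d ->
  exists C delta : R, 0 < delta /\
    forall (y v1 : 'cV[R]_(n + n)) (V : 'M[R]_(n + n, k)) (muk kappa : R)
      (yt : 'cV[R]_(n + n)) (sRA : 'cV[R]_n),
    let H := V^T *m M *m V in
    let P := orth_proj V in
    let eps := sin (subspace_angle y P) in
    let gamma := opnorm2 (P *m M *m (1%:M - P)) in
    let yt1 := usubmx yt in
    let yt2 := dsubmx yt in
    norm2 y = 1 -> M *m y = mu1 *: y ->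
    norm2 v1 = 1 ->
    \rank (krylov_mx k v1 M) = k ->
    krylov_onb v1 M V ->
    rightmost_eigenvalue H muk ->
    simple_eigenvalue H muk ->
    eigenvalue_condition H muk kappa ->
    kappa <= kbar ->
    other_eigenvalues_apart H muk mu1 d ->
    refined_ritz_vector k v1 M muk yt ->
    yt1 != 0 ->
    dotv g yt2 != 0 ->
    sRA = - (Delta ^+ 2 / dotv g yt2) *: yt1 ->
    sRA = - (Num.sg (dotv g yt2) * Delta / norm2 yt1) *: yt1 ->
    eps <= delta ->
    norm2 ((A + muk%:M) *m sRA + g) <=
      (opnorm2 (M - muk%:M) + kappa * gamma) * Delta
        / (norm2 yt1 * Num.sqrt (1 - eps ^+ 2)) * eps
      + C * eps ^+ 2.
Proof.
move=> M kbar d d0.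
(* The absolute value keeps the thresholds below positive for every kbar. *)
pose kb := `|kbar|; pose N := opnorm2 M.
pose K := separation_const k N mu1 d kb.
have uA := shifted_mx_unit symA Delta_gt0 sopt_bnd lam_opt easy mu1_right.
have [c c0 Ac] := unitmx_lower_bound uA.
have N0 : 0 <= N := opnorm2_ge0 _.
have kb0 : 0 <= kb := normr_ge0 _.
have K0 : 0 <= K := separation_const_ge0 _ _ N0 d0 kb0.
have KN1 : 0 < 1 + K * N by rewrite ltr_pwDl // mulr_ge0.
have Q0 : 0 < 6 * kb * N + 4 * N + 1.
  by rewrite ltr_wpDl // addr_ge0 // !mulr_ge0.
exists (8 * Delta * (1 + c) * (1 + K * N) * kb * N / c).
exists (Num.min ((1 + K * N)^-1 / 2) (c / (2 * (6 * kb * N + 4 * N + 1)))).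
split; first by rewrite lt_min !divr_gt0 ?invr_gt0 ?mulr_gt0.
move=> y v1 V mu kappa yt sRA H P eps gamma yt1 yt2 y1 My _ _ [orthoV VK].
move=> [muH _] simpleH condH kappa_le apartH refined yt1_neq0 gyt_neq0.
move=> sRAE sRAE'; rewrite le_min => /andP[epsK epsQ].
have epsE : eps = norm2 (y - P *m y) := sin_subspace_angle orthoV y1.
have eps0 : 0 <= eps by rewrite epsE norm2_ge0.
have coE : Num.sqrt (1 - eps ^+ 2) = norm2 (V^T *m y).
  by rewrite epsE cos_subspace_angle.
have b0 : 0 < norm2 yt1 by rewrite lt_def norm2_eq0 yt1_neq0 norm2_ge0.
have scaleE : `|Delta ^+ 2 / dotv g yt2| = Delta / norm2 yt1.
  have := congr1 norm2 (etrans (esym sRAE) sRAE').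
  rewrite !norm2Z !normrN => /(mulIf (lt0r_neq0 b0)) ->.
  by rewrite !normrM normr_sg gyt_neq0 mul1r normfV !gtr0_norm.
have kappa0 : 0 <= kappa by case: condH => u [z [_ _ _ _ ->]]; rewrite invr_ge0.
have kappa_kb : kappa <= kb by apply: le_trans kappa_le (ler_norm _).
have HN v : norm2 (H *m v) <= N * norm2 v := norm2_compression_le orthoV M v.
have mu_le : `|mu| <= N.
  case: condH => u [z [_ z1 _ Hz _]].
  by have := HN z; rewrite Hz norm2Z z1 !mulr1.
have L_le : opnorm2 (M - mu%:M) <= N + N.
  by apply: le_trans (opnorm2_shift_le _ _) _; rewrite lerD2l.
have yt_norm : norm2 yt = 1 by case: refined.
have r_le := compression_residual_le orthoV My; rewrite -epsE in r_le.
have dist := ritz_value_distance (V^T *m y) d0 simpleH condH kappa_kb apartH HN.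
have refl := refined_residual_le orthoV y VK refined.
rewrite coE sRAE.
apply: (@residual_bookkeeping R N K kb c Delta eps (norm2 (V^T *m y))
  `|mu - mu1| kappa gamma (opnorm2 (M - mu%:M))
  (norm2 ((M - mu%:M) *m yt)) (norm2 yt1)) => //.
- have := orth_proj_pythagoras orthoV y; rewrite -/P -epsE y1.
  have := norm2_ge0 (V^T *m y); move: (norm2 _) => co.
  nra.
- by rewrite kappa0.
- by rewrite opnorm2_ge0 coupling_opnorm_le.
- by rewrite opnorm2_ge0.
- apply: le_trans (ler_wpM2l kappa0 r_le); apply: le_trans dist.
  by rewrite ler_wpM2r // lerD2l lerN2 ler_wpM2l.
- apply: le_trans refl _; rewrite epsE; exact: proj_residual_le.
- by rewrite -scaleE; exact: trs_residual_le.
- exact: first_block_lower_bound.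
Qed.
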